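(* Let $G$ be a connected non-compact real semisimple Lie group, $\sigma$ an involutive automorphism of $G$, and $H$ a closed subgroup of $G$ with $(G^\sigma)_0\subset H\subset G^\sigma$ (so that $G/H$ is a semisimple symmetric space). Let $\theta$ be a Cartan involution of $G$ commuting with $\sigma$, $K=G^\theta$, $K_H=K\cap H$, $\mathfrak a_0$ a maximal abelian subspace of $\mathfrak p_0\cap\mathfrak q_0$, and $A=\exp\mathfrak a_0$. Then the Weyl group $W_{K\times H}(A)=N_{K\times H}(A)/Z_{K\times H}(A)$ of $G/H$ coincides with the image $\widetilde\Delta(W_{K_H}(A))$ of $W_{K_H}(A)=N_{K_H}(A)/Z_{K_H}(A)$ under the group homomorphism $\widetilde\Delta: W_{K_H}(A)\to W_{K\times H}(A)$ sending the class of $\ell\in N_{K_H}(A)$ to the class of $(\ell,\ell)$. In particular, there is a group isomorphism $W_{K\times H}(A)\simeq W_{K_H}(A)$.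
   Context: For an automorphism $\nu$ of $G$, $G^\nu=\{g\in G:\nu(g)=g\}$, and $(G^\nu)_0$ is its identity component. The differentials of $\sigma,\theta$ on the Lie algebra $\mathfrak g_0$ of $G$ are denoted by the same letters. $\mathfrak p_0=\{X\in\mathfrak g_0:\theta(X)=-X\}$ and $\mathfrak q_0=\{X\in\mathfrak g_0:\sigma(X)=-X\}$. The group $K=G^\theta$ is connected and is a maximal compact subgroup of $G$. A maximal abelian subspace of $\mathfrak p_0\cap\mathfrak q_0$ is an abelian subspace that is maximal among abelian subspaces contained in $\mathfrak p_0\cap\mathfrak q_0$. Actions and groups: $G\times G$ acts on $G$ by $(g_1,g_2)\cdot x=g_1xg_2^{-1}$, and $G$ acts on $G$ by $g\cdot x=gxg^{-1}$. Define $N_{K\times H}(A)=\{(k,h)\in K\times H:(k,h)\cdot A=A\}$, $Z_{K\times H}(A)=\{(k,h)\in K\times H:(k,h)\cdot a=a\ \text{for all } a\in A\}$, $N_{K_H}(A)=\{k\in K_H: k\cdot A=A\}$, $Z_{K_H}(A)=\{k\in K_H: k\cdot a=a\ \text{for all } a\in A\}$. The $Z$-groups are normal subgroups of the corresponding $N$-groups. The diagonal embedding $\ell\mapsto(\ell,\ell)$ maps $N_{K_H}(A)$ into $N_{K\times H}(A)$ and $Z_{K_H}(A)$ into $Z_{K\times H}(A)$, so $\widetilde\Delta$ is well defined. *)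

(* Defs.v *)
From HB Require Import structures.
From mathcomp Require Import all_boot all_order all_algebra.
From mathcomp Require Import all_classical all_reals all_analysis.

Set Implicit Arguments.
Unset Strict Implicit.
Unset Printing Implicit Defensive.

Import Order.TTheory GRing.Theory Num.Theory.
Import numFieldNormedType.Exports.

Local Open Scope classical_set_scope.
Local Open Scope ring_scope.

Section Smooth.
Context {R : realType}.
Implicit Types V W : normedModType R.

(* For finite-dimensional V this is the usual class C^k on the open set U. *)
Fixpoint Ck_on V W (k : nat) (U : set V) (f : V -> W) : Prop :=
  if k is k'.+1 then
    (forall x, U x -> differentiable f x) /\ (forall v, Ck_on k' U ('D_v f))
  else {in U, continuous f}.

Definition smooth_on V W (U : set V) (f : V -> W) : Prop :=
  forall k, Ck_on k U f.

(* cinv is only meaningful on the image of cdom under cmap, and cmap only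
   on cdom. *)
Record chart (V : normedModType R) (M : topologicalType) := Chart {
  cdom : set M;
  cmap : M -> V;
  cinv : V -> M }.

Definition cimg V (M : topologicalType) (c : chart V M) : set V :=
  cmap c @` cdom c.

Definition is_chart V (M : topologicalType) (c : chart V M) : Prop :=
  [/\ open (cdom c) /\ open (cimg c),
      {in cdom c, cancel (cmap c) (cinv c)},
      {in cdom c, continuous (cmap c)} &
      {in cimg c, continuous (cinv c)}].

Definition smooth_compatible V (M : topologicalType) (c d : chart V M) : Prop :=
  smooth_on (cmap c @` (cdom c `&` cdom d)) (cmap d \o cinv c).

Definition smooth_atlas V (M : topologicalType) (A : set (chart V M)) : Prop :=
  [/\ (forall c, A c -> is_chart c),
      (forall c d, A c -> A d -> smooth_compatible c d) &
      (forall x, exists2 c, A c & cdom c x)].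

Definition smooth_map V W (M N : topologicalType)
    (A : set (chart V M)) (B : set (chart W N)) (f : M -> N) : Prop :=
  continuous f /\
  forall c d, A c -> B d ->
    smooth_on (cmap c @` (cdom c `&` f @^-1` cdom d)) (cmap d \o f \o cinv c).

Definition prod_chart V W (M N : topologicalType)
    (c : chart V M) (d : chart W N) : chart (V * W)%type (M * N)%type :=
  Chart (cdom c `*` cdom d)
    (fun x => (cmap c x.1, cmap d x.2)) (fun u => (cinv c u.1, cinv d u.2)).

Definition prod_atlas V W (M N : topologicalType)
    (A : set (chart V M)) (B : set (chart W N)) :
    set (chart (V * W)%type (M * N)%type) :=
  [set prod_chart c d | c in A & d in B].

Definition line_atlas : set (chart R^o R^o) := [set Chart setT id id].

End Smooth.

HB.mixin Record isLieGroup (R : realType) (n : nat) G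
    of monoid.Group G & Topological G := {
  lie_atlas : set (chart 'rV[R]_n G);
  lie_atlasP : smooth_atlas lie_atlas;
  lie_hausdorff : hausdorff_space G;
  lie_second_countable : @second_countable G;
  lie_mul_smooth : smooth_map (prod_atlas lie_atlas lie_atlas) lie_atlas
    (fun x : G * G => (x.1 * x.2)%g);
  lie_inv_smooth : smooth_map lie_atlas lie_atlas (fun x : G => (x^-1)%g)
}.

#[short(type="lieGroupType")]
HB.structure Definition LieGroup (R : realType) (n : nat) :=
  {G of monoid.Group G & Topological G & isLieGroup R n G}.

Section LieAlgebra.
Context {R : realType} {n : nat} (G : lieGroupType R n).
Implicit Types (X Y Z : 'rV[R]_n) (nu : G -> G).

Let atlas : set (chart 'rV[R]_n G) := lie_atlas.

Lemma chart_at_1 : exists2 c, atlas c & cdom c (1%g : G).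
Proof. by case: (lie_atlasP (s := G)) => _ _; apply. Qed.

(* The tangent space of G at 1, i.e. the underlying space of the Lie algebra,
   is identified with 'rV[R]_n by means of this one chart around 1. *)
Definition chart1 : chart 'rV[R]_n G := s2val (cid2 chart_at_1).

(* The differential at 1 of a map fixing 1. *)
Definition tangent1 (f : G -> G) : 'rV[R]_n -> 'rV[R]_n :=
  'd (cmap chart1 \o f \o cinv chart1) (cmap chart1 1%g).

Definition Ad (g : G) : 'rV[R]_n -> 'rV[R]_n :=
  tangent1 (fun x => (g * x * g^-1)%g).

(* ad is the differential of Ad at 1. *)
Definition lie_bracket X Y : 'rV[R]_n :=
  'D_X (fun u => Ad (cinv chart1 u) Y) (cmap chart1 1%g).

Definition killing_form X Y : R :=
  \tr (lin1_mx (fun Z => lie_bracket X (lie_bracket Y Z))).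

Definition one_parameter_subgroup (c : R^o -> G) X : Prop :=
  [/\ smooth_map line_atlas atlas c,
      (forall s t, c (s + t) = (c s * c t)%g) &
      is_derive (0 : R^o) (1 : R^o) (cmap chart1 \o c) X].

(* By existence and uniqueness of one-parameter subgroups the default value 1
   of xget is never used. *)
Definition lie_exp X : G :=
  xget 1%g [set c 1 | c in [set c | one_parameter_subgroup c X]].

Definition lie_ideal (I : {vspace 'rV[R]_n}) : Prop :=
  forall X Y, Y \in I -> lie_bracket X Y \in I.

Fixpoint derived_series (I : {vspace 'rV[R]_n}) (k : nat)
    : {vspace 'rV[R]_n} :=
  if k is k'.+1 then
    let J := derived_series I k' in
    <<[seq lie_bracket X Y | X <- vbasis J, Y <- vbasis J]>>%VS
  else I.

Definition lie_solvable (I : {vspace 'rV[R]_n}) : Prop :=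
  exists k, derived_series I k = 0%VS.

Definition semisimple : Prop :=
  forall I : {vspace 'rV[R]_n}, lie_ideal I -> lie_solvable I -> I = 0%VS.

Definition involutive_automorphism nu : Prop :=
  [/\ {morph nu : x y / (x * y)%g}, smooth_map atlas atlas nu & involutive nu].

Definition cartan_involution nu : Prop :=
  involutive_automorphism nu /\
  (forall X, X != 0 -> 0 < - killing_form X (tangent1 nu X)).

Definition fixed_points nu : set G := [set g | nu g = g].

Definition minus_eigenspace nu : set 'rV[R]_n := [set X | tangent1 nu X = - X].

Definition abelian_in (S : set 'rV[R]_n) (a : {vspace 'rV[R]_n}) : Prop :=
  (forall X, X \in a -> S X) /\
  (forall X Y, X \in a -> Y \in a -> lie_bracket X Y = 0).

Definition maximal_abelian_in (S : set 'rV[R]_n) (a : {vspace 'rV[R]_n})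
    : Prop :=
  abelian_in S a /\ forall b, abelian_in S b -> (a <= b)%VS -> b = a.

End LieAlgebra.

Section Groups.
Local Open Scope group_scope.

Definition subgroup (T : groupType) (S : set T) : Prop :=
  [/\ S 1, (forall x y, S x -> S y -> S (x * y)) &
      (forall x, S x -> S x^-1)].

Definition maximal_compact_subgroup (R : realType) (n : nat)
    (G : lieGroupType R n) (K : set G) : Prop :=
  [/\ subgroup K, compact K &
      forall L : set G, subgroup L -> compact L -> K `<=` L -> L = K].

Section Weyl.
Context {T : groupType} {X : Type} (act : T -> X -> X).

Definition normalizer (S : set T) (A : set X) : set T :=
  [set s | S s /\ act s @` A = A].

Definition centralizer (S : set T) (A : set X) : set T :=
  [set s | S s /\ forall a, A a -> act s a = a].

Definition left_coset (x : T) (Z : set T) : set T := [set x * z | z in Z].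

(* A quotient group is represented by its set of cosets, multiplied elementwise
   as sets by mulset. *)
Definition mulset (C D : set T) : set T := [set x * y | x in C & y in D].

Definition weyl (S : set T) (A : set X) : set (set T) :=
  [set left_coset x (centralizer S A) | x in normalizer S A].

Context (act1 : forall a, act 1 a = a).
Context (actM : forall s t a, act (s * t) a = act s (act t a)).

Lemma centralizer_subgroup S A : subgroup S -> subgroup (centralizer S A).
Proof.
move=> [S1 SM SV]; split.
- by split=> // a _; rewrite act1.
- move=> x y [Sx fx] [Sy fy]; split; first exact: SM.
  by move=> a Aa; rewrite actM fy // fx.
- move=> x [Sx fx]; split; first exact: SV.
  by move=> a Aa; rewrite -{1}(fx a Aa) -actM mulVg act1.
Qed.

Lemma normalizer_subgroup S A : subgroup S -> subgroup (normalizer S A).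
Proof.
move=> [S1 SM SV]; split.
- split=> //; apply/seteqP; split=> [a [b Ab <-]|a Aa]; first by rewrite act1.
  by exists a; rewrite ?act1.
- move=> x y [Sx Ax] [Sy Ay]; split; first exact: SM.
  rewrite -[RHS]Ax -{2}Ay image_comp.
  by apply: eq_imagel => a _ /=; rewrite actM.
- move=> x [Sx Ax]; split; first exact: SV.
  rewrite -{1}Ax image_comp.
  apply/seteqP; split=> [a [b Ab <-]|a Aa] /=; first by rewrite -actM mulVg act1.
  by exists a => //=; rewrite -actM mulVg act1.
Qed.

Lemma centralizer_normal S A x z : subgroup S ->
  normalizer S A x -> centralizer S A z -> centralizer S A (x^-1 * z * x).
Proof.
move=> [S1 SM SV] [Sx Ax] [Sz fz]; split.
  by apply: (SM) => //; apply: (SM) => //; apply: SV.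
move=> a Aa; rewrite !actM fz; last by rewrite -Ax; exists a.
by rewrite -actM mulVg act1.
Qed.

Lemma mulset_left_coset S A x y : subgroup S -> normalizer S A y ->
  mulset (left_coset x (centralizer S A)) (left_coset y (centralizer S A))
  = left_coset (x * y) (centralizer S A).
Proof.
move=> sS Ny; have [Z1 ZM _] := centralizer_subgroup A sS.
apply/seteqP; split=> [_ [_ [z Zz <-] [_ [t Zt <-] <-]]|_ [z Zz <-]].
  exists (y^-1 * z * y * t); first by apply: ZM => //; exact: centralizer_normal.
  by rewrite !mulgA mulgK.
exists x; first by exists 1; rewrite ?mulg1.
by exists (y * z); [exists z | rewrite mulgA].
Qed.

End Weyl.

Definition group_isomorphic (T U : groupType)
    (P : set (set T)) (Q : set (set U)) : Prop :=
  exists f : set T -> set U,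
    set_bij P Q f /\ {in P &, {morph f : C D / mulset C D}}.

Section Actions.
Context {G : groupType}.

Definition two_sided (g : G * G) (x : G) : G := g.1 * x * g.2^-1.

Definition conjugation (g x : G) : G := g * x * g^-1.

Lemma two_sided1 x : two_sided 1 x = x.
Proof. by rewrite /two_sided /= invg1 mulg1 mul1g. Qed.

Lemma two_sidedM g h x : two_sided (g * h) x = two_sided g (two_sided h x).
Proof. by rewrite /two_sided /= invgM !mulgA. Qed.

Lemma conjugation1 x : conjugation 1 x = x.
Proof. by rewrite /conjugation invg1 mulg1 mul1g. Qed.

Lemma conjugationM g h x :
  conjugation (g * h) x = conjugation g (conjugation h x).
Proof. by rewrite /conjugation invgM !mulgA. Qed.

(* For a coset C of Z_{K_H}(A) in N_{K_H}(A), this is the coset of Z that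
   contains the pairs (l, l) with l in C. *)
Definition diag_class (Z : set (G * G)) (C : set G) : set (G * G) :=
  mulset [set (l, l) | l in C] Z.

End Actions.
End Groups.

(* Main.v *)
(* Let (k, h) map A to itself. As 1 is in A, a := k h^-1 lies in A, say
   a = exp X with X in a0, and sigma a = theta a = a^-1. Comparing sigma k and
   theta (sigma k) gives a^4 = 1. For the inner product
   b(U, V) = - B(U, theta V) the operators S = Ad (exp (t X)) are symmetric, so
   S^4 = 1 forces S^2 = 1; starting from exp (4 X) = 1 this gives
   Ad (exp (4 X / 2^m)) = 1 for all m, and differentiating at 0 yields ad X = 0.
   Then b(X, X) = 0, so X = 0 and a = 1, i.e. k = h: every element
   of the normalizer in K x H is diagonal. *)

Require Import Defs.
From HB Require Import structures.
From mathcomp Require Import all_boot all_order all_algebra.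
From mathcomp Require Import all_classical all_reals all_analysis.

Set Implicit Arguments.
Unset Strict Implicit.
Unset Printing Implicit Defensive.

Import Order.TTheory GRing.Theory Num.Theory.
Import numFieldNormedType.Exports.

Local Open Scope classical_set_scope.
Local Open Scope ring_scope.

(** * Differentiability in charts *)

(** The halving works because S^2 is symmetric and positive for b, and a positive operator whose
    square is the identity is the identity. Every element of a one-parameter subgroup is a square,
    so the step can be repeated at ever smaller times; the starting time 4 is the exponent in a^4 =
    1. The symmetry of S rests on theta (exp (t X)) = exp (- t X), which comes from the uniqueness
    of one-parameter subgroups with given velocity. The obstacle on the analytic side is that the
    bracket is given only as a directional derivative of [Ad] in one chart. Its bilinearity and its
    compatibility with homomorphisms, hence the [Ad]-invariance of the Killing form, have to be
    extracted from the smoothness of the multiplication. Once normalizing pairs are diagonal, the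
    statement on Weyl groups is formal, since (l, l) acts on G as conjugation by l. *)

Section ManifoldDifferentiability.
Context {R : realType}.
Implicit Types U V W : normedModType R.

(** The remainder estimate of [f] serves for [g] near [x]. Composites of charts agree with the
    intended maps only near a point, so nearly every computation of a differential below passes
    through this. *)
Lemma near_eq_is_diff V W (f g df : V -> W) (x : V) :
  (\near x, f x = g x) -> is_diff x f df -> is_diff x g df.
Proof.
move=> fg [dfx <-].
have gx : g \o shift x = cst (g x) + 'd f x +o_ 0 id.
  apply/eqaddoP => e e0; move/diff_locally/eqaddoP: (dfx) => /(_ e e0).
  rewrite !near_simpl; apply: filter_app.
  move: (fg); rewrite [X in X -> _](near_shift 0) /= => fg0.
  near=> h; have hx : f (h + x) = g (h + x).
    by near: h; move: fg0; apply: filterS => h; rewrite /= subr0.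
  have E k : (k \o shift x - (cst (k x) + 'd f x)) h =
    k (h + x) - (k x + 'd f x h) by [].
  by rewrite !E -hx -(nbhs_singleton fg).
have gE : 'd g x = 'd f x :> (V -> W).
  by apply: diff_unique => //; exact: diff_continuous.
apply: DiffDef => //; apply/diff_locallyP; rewrite gE; split=> //.
exact: diff_continuous.
Unshelve. all: by end_near. Qed.

(** What the chain rule asks of an atlas: a genuine chart around each intermediate point. Transition
    maps do not enter, because [mdiff] quantifies over all charts; product atlases and the line are
    therefore quick to treat. *)
Definition charts_cover V (M : topologicalType) (A : set (chart V M)) : Prop :=
  (forall c, A c -> is_chart c) /\ forall x, exists2 c, A c & cdom c x.

Lemma smooth_atlas_cover V (M : topologicalType) (A : set (chart V M)) :
  smooth_atlas A -> charts_cover A.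
Proof. by case. Qed.

Section Chart.
Context V (M : topologicalType) (c : chart V M) (x : M).
Hypotheses (cP : is_chart c) (cx : cdom c x).

Lemma nbhs_cdom : nbhs x (cdom c).
Proof. by case: cP => -[oc _] _ _ _; exact: open_nbhs_nbhs. Qed.

Lemma nbhs_cimg : nbhs (cmap c x) (cimg c).
Proof.
by case: cP => -[_ oc] _ _ _; apply: open_nbhs_nbhs; split=> //; exists x.
Qed.

Lemma cmapK : cinv c (cmap c x) = x.
Proof. by case: cP => _ + _ _; apply; exact: mem_set. Qed.

Lemma cmap_continuous : {for x, continuous (cmap c)}.
Proof. by case: cP => _ _ + _; apply; exact: mem_set. Qed.

Lemma cinv_continuous : {for cmap c x, continuous (cinv c)}.
Proof. by case: cP => _ _ _; apply; apply: mem_set; exists x. Qed.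

Lemma cinv_cvg : cinv c @ cmap c x --> x.
Proof. by move: cinv_continuous; rewrite /prop_for /continuous_at cmapK. Qed.

End Chart.

Lemma cinvK V (M : topologicalType) (c : chart V M) u :
  is_chart c -> cimg c u -> cmap c (cinv c u) = u.
Proof. by move=> cP [x cx <-]; rewrite cmapK. Qed.

Lemma cdom_cinv V (M : topologicalType) (c : chart V M) u :
  is_chart c -> cimg c u -> cdom c (cinv c u).
Proof. by move=> cP [x cx <-]; rewrite cmapK. Qed.

(** The tangent map of [f] at [x] read in two charts; [tangent1] is the case where both are [chart1]
    and [x] is 1. *)
Definition chart_diff V W (M N : topologicalType) (c : chart V M)
    (d : chart W N) (f : M -> N) (x : M) : V -> W :=
  'd (cmap d \o f \o cinv c) (cmap c x).

Definition mdiff V W (M N : topologicalType)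
    (A : set (chart V M)) (B : set (chart W N)) (f : M -> N) (x : M) : Prop :=
  {for x, continuous f} /\
  forall c d, A c -> B d -> cdom c x -> cdom d (f x) ->
    differentiable (cmap d \o f \o cinv c) (cmap c x).

Lemma smooth_mdiff V W (M N : topologicalType)
    (A : set (chart V M)) (B : set (chart W N)) (f : M -> N) (x : M) :
  smooth_map A B f -> mdiff A B f x.
Proof.
move=> [fc fs]; split=> [|c d Ac Bd cx dfx]; first exact: fc.
by have [+ _] := fs c d Ac Bd 1%N; apply; exists x.
Qed.

(** In charts the identity is a transition map, so this is the compatibility of the atlas at order
    one. *)
Lemma mdiff_id V (M : topologicalType) (A : set (chart V M)) (x : M) :
  smooth_atlas A -> mdiff A A id x.
Proof.
move=> [_ As _]; split=> [|c d Ac Ad cx dx]; first exact: cvg_id.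
by have [+ _] := As c d Ac Ad 1%N; apply; exists x.
Qed.

Lemma mdiff_cst V W (M N : topologicalType) (A : set (chart V M))
    (B : set (chart W N)) (x : M) (y : N) : mdiff A B (fun=> y) x.
Proof.
split=> [|c d _ _ _ _]; first exact: cst_continuous.
exact: (differentiable_cst (cmap d y)).
Qed.

(** Chain rule: inserting [cinv d \o cmap d] between [f] and [g] changes nothing near [x], because
    continuity of [f] keeps the image inside [cdom d]. *)
Lemma is_diff_chart_comp V W U (M N P : topologicalType)
    (A : set (chart V M)) (B : set (chart W N)) (C : set (chart U P))
    (f : M -> N) (g : N -> P) (x : M) c d e :
  is_chart c -> is_chart d -> A c -> B d -> C e ->
  cdom c x -> cdom d (f x) -> cdom e (g (f x)) ->
  mdiff A B f x -> mdiff B C g (f x) ->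
  is_diff (cmap c x) (cmap e \o (g \o f) \o cinv c)
    (chart_diff d e g (f x) \o chart_diff c d f x).
Proof.
move=> cP dP Ac Bd Ce cx dfx egfx [fc fd] [gc gd].
have := fd c d Ac Bd cx dfx => /differentiableP dfc.
have := gd d e Bd Ce dfx egfx => /differentiableP dgd.
have {}dgd : is_diff ((cmap d \o f \o cinv c) (cmap c x))
    (cmap e \o g \o cinv d) (chart_diff d e g (f x)).
  by rewrite /= cmapK.
apply: near_eq_is_diff (is_diff_comp dfc dgd).
have : \forall u \near cmap c x, cdom d (f (cinv c u)).
  have cf : (f \o cinv c) u @[u --> cmap c x] --> f x.
    exact: (cvg_comp _ _ (cinv_cvg cP cx) fc).
  exact: cf (nbhs_cdom dP dfx).
by apply: filterS => u du /=; rewrite (cmapK dP).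
Qed.

Lemma mdiff_comp V W U (M N P : topologicalType)
    (A : set (chart V M)) (B : set (chart W N)) (C : set (chart U P))
    (f : M -> N) (g : N -> P) (x : M) :
  charts_cover A -> charts_cover B ->
  mdiff A B f x -> mdiff B C g (f x) -> mdiff A C (g \o f) x.
Proof.
move=> [Ac _] [Bc Bex] mf mg; split=> [|c e Acc Ce cx egfx].
  by apply: continuous_comp; [case: mf|case: mg].
have [d Bd dfx] := Bex (f x).
have [] := is_diff_chart_comp (Ac _ Acc) (Bc _ Bd) Acc Bd Ce cx dfx egfx mf mg.
by [].
Qed.

Lemma chart_diff_comp V W U (M N P : topologicalType)
    (A : set (chart V M)) (B : set (chart W N)) (C : set (chart U P))
    (f : M -> N) (g : N -> P) (x : M) c d e :
  is_chart c -> is_chart d -> A c -> B d -> C e ->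
  cdom c x -> cdom d (f x) -> cdom e (g (f x)) ->
  mdiff A B f x -> mdiff B C g (f x) ->
  chart_diff c e (g \o f) x = chart_diff d e g (f x) \o chart_diff c d f x.
Proof.
by move=> cP dP Ac Bd Ce cx dx ex mf mg;
  have [] := is_diff_chart_comp cP dP Ac Bd Ce cx dx ex mf mg.
Qed.

(** * Product charts and the chart of the real line *)

Lemma open_setX (M N : topologicalType) (A : set M) (B : set N) :
  open A -> open B -> open (A `*` B).
Proof.
move=> oA oB; rewrite openE => -[x y] [/= Ax By]; exists (A, B) => //=.
by split; exact: open_nbhs_nbhs.
Qed.

Lemma prod_is_chart V W (M N : topologicalType) (c : chart V M)
    (d : chart W N) : is_chart c -> is_chart d -> is_chart (prod_chart c d).
Proof.
move=> cP dP; have [[oc oc'] _ _ _] := cP; have [[od od'] _ _ _] := dP.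
have imgE : cimg (prod_chart c d) = cimg c `*` cimg d.
  apply/seteqP; split=> [_ [[x y] [/= cx dy] <-]|[u v] [[x cx xu] [y dy yv]]].
    by split; [exists x|exists y].
  by exists (x, y) => //=; rewrite xu yv.
split.
- by rewrite imgE; split; exact: open_setX.
- by move=> [x y] /set_mem [/= cx dy] /=; rewrite (cmapK cP cx) (cmapK dP dy).
- move=> [x y] /set_mem [/= cx dy].
  apply: cvg_pair; apply: continuous_comp => /=.
  + exact: cvg_fst.
  + exact: (cmap_continuous cP cx).
  + exact: cvg_snd.
  + exact: (cmap_continuous dP dy).
- rewrite imgE => -[u v] /set_mem [[x cx /= <-] [y dy /= <-]].
  apply: cvg_pair; apply: continuous_comp => /=.
  + exact: cvg_fst.
  + exact: (cinv_continuous cP cx).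
  + exact: cvg_snd.
  + exact: (cinv_continuous dP dy).
Qed.

Lemma prod_atlas_cover V W (M N : topologicalType) (A : set (chart V M))
    (B : set (chart W N)) :
  charts_cover A -> charts_cover B -> charts_cover (prod_atlas A B).
Proof.
move=> [Ac Aex] [Bc Bex]; split=> [_ [c /Ac cP [d /Bc dP <-]]|[x y]].
  exact: prod_is_chart.
have [c Acc cx] := Aex x; have [d Bd dy] := Bex y.
by exists (prod_chart c d) => //; exists c => //; exists d.
Qed.

Lemma mdiff_pair V W U (M N P : topologicalType) (A : set (chart V M))
    (B : set (chart W N)) (C : set (chart U P)) (f : M -> N) (g : M -> P) x :
  mdiff A B f x -> mdiff A C g x ->
  mdiff A (prod_atlas B C) (fun x => (f x, g x)) x.
Proof.
move=> [fc fd] [gc gd]; split=> [|c _ Ac [d Bd [e Ce <-]] cx [/= dx ex]].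
  exact: cvg_pair.
by apply: differentiable_pair; [exact: fd|exact: gd].
Qed.

Lemma chart_diff_pair V W U (M N P : topologicalType) (A : set (chart V M))
    (B : set (chart W N)) (C : set (chart U P)) (f : M -> N) (g : M -> P) x
    c d e : A c -> B d -> C e -> cdom c x -> cdom d (f x) -> cdom e (g x) ->
  mdiff A B f x -> mdiff A C g x ->
  chart_diff c (prod_chart d e) (fun x => (f x, g x)) x =
  (fun v => (chart_diff c d f x v, chart_diff c e g x v)).
Proof.
move=> Ac Bd Ce cx dx ex [fc fd] [gc gd].
by apply: (@diff_pair _ _ _ _ (cmap d \o f \o cinv c) (cmap e \o g \o cinv c));
  [exact: fd|exact: gd].
Qed.

Lemma line_is_chart : is_chart (Chart setT id id : chart R^o R^o).
Proof.
have -> : is_chart (Chart setT id id : chart R^o R^o) =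
  [/\ open [set: R^o] /\ open ([set: R^o] : set R^o),
      {in [set: R^o], cancel id id},
      {in [set: R^o], continuous (@id R^o)} &
      {in [set: R^o], continuous (@id R^o)}].
  by rewrite /is_chart /cimg /= image_id.
by split=> //; do ?[split; exact: openT]; move=> x _; exact: cvg_id.
Qed.

Lemma line_atlas_cover : charts_cover (@line_atlas R).
Proof.
by split=> [_ ->|x]; [exact: line_is_chart|exists (Chart setT id id)].
Qed.

End ManifoldDifferentiability.

(** * Lie groups *)

Section LieGroupCalculus.
Context {R : realType} {n : nat} (G : lieGroupType R n).
Local Notation atlas := (lie_atlas (s := G)).
Local Notation ch := (chart1 G).
Local Notation line := (Chart setT id id : chart R^o R^o).
Implicit Types (X Y Z : 'rV[R]_n) (f g : G -> G) (c d : R^o -> G).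

Lemma lie_cover : charts_cover atlas.
Proof. exact/smooth_atlas_cover/lie_atlasP. Qed.

Lemma chart1_atlas : atlas ch.
Proof. by rewrite /chart1; case: cid2. Qed.

Lemma chart1_1 : cdom ch 1%g.
Proof. by rewrite /chart1; case: cid2. Qed.

Lemma chart1_is_chart : is_chart ch.
Proof. by have [+ _] := lie_cover; apply; exact: chart1_atlas. Qed.

Local Hint Resolve lie_cover chart1_atlas chart1_1 chart1_is_chart : core.
Local Hint Resolve line_is_chart line_atlas_cover : core.

Lemma mdiff_mul (p : G * G) :
  mdiff (prod_atlas atlas atlas) atlas (fun x => (x.1 * x.2)%g) p.
Proof. exact/smooth_mdiff/lie_mul_smooth. Qed.

Lemma mdiff_inv (x : G) : mdiff atlas atlas (fun x => (x^-1)%g) x.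
Proof. exact/smooth_mdiff/lie_inv_smooth. Qed.

Lemma mdiff_mulf V (M : topologicalType) (A : set (chart V M))
    (f g : M -> G) (x : M) : charts_cover A ->
  mdiff A atlas f x -> mdiff A atlas g x ->
  mdiff A atlas (fun x => (f x * g x)%g) x.
Proof.
move=> Ac mf mg; apply: (mdiff_comp Ac _ (mdiff_pair mf mg) (mdiff_mul _)).
exact: prod_atlas_cover.
Qed.

Lemma mdiff_translation (a b x : G) :
  mdiff atlas atlas (fun x => (a * x * b)%g) x.
Proof.
apply: mdiff_mulf => //; last exact: mdiff_cst.
apply: mdiff_mulf => //; first exact: mdiff_cst.
exact/mdiff_id/lie_atlasP.
Qed.

Lemma tangent1_comp f g : f 1%g = 1%g -> g 1%g = 1%g ->
  mdiff atlas atlas f 1%g -> mdiff atlas atlas g 1%g ->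
  tangent1 (g \o f) = tangent1 g \o tangent1 f.
Proof.
move=> f1 g1 mf mg.
have := @chart_diff_comp _ _ _ _ _ _ _ atlas atlas atlas f g 1%g ch ch ch.
by rewrite /chart_diff f1 g1; apply.
Qed.

Lemma chart_diff_id : chart_diff ch ch id (1%g : G) = id.
Proof.
have idE : \forall u \near cmap ch 1%g, u = (cmap ch \o id \o cinv ch) u.
  apply: filterS (nbhs_cimg chart1_is_chart chart1_1) => u ? /=.
  by rewrite cinvK.
by have [_] := near_eq_is_diff idE (is_diff_id _).
Qed.

Lemma chart_diff_cst V (M : topologicalType) (c : chart V M) (x : M) (y : G) :
  chart_diff c ch (fun=> y) x = 0.
Proof. exact: (diff_cst (cmap ch y)). Qed.

(** The differential is linear, so it is determined on the two axes; there it is the differential of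
    x * 1 or of 1 * x, the identity. *)
Lemma chart_diff_mul1 X Y : chart_diff (prod_chart ch ch) ch
  (fun x : G * G => (x.1 * x.2)%g) (1%g, 1%g) (X, Y) = X + Y.
Proof.
have cc : prod_atlas atlas atlas (prod_chart ch ch).
  by exists ch => //; exists ch.
have mid : mdiff atlas atlas id (1%g : G) by exact/mdiff_id/lie_atlasP.
have mc : mdiff atlas atlas (fun=> 1%g) (1%g : G) by exact: mdiff_cst.
have pc : is_chart (prod_chart ch ch) by exact: prod_is_chart.
set D := chart_diff _ _ _ _.
have DD : D (X, Y) = D (X, 0) + D (0, Y).
  have -> : (X, Y) = (X, 0) + (0, Y).
    by rewrite -[RHS]/(X + 0, 0 + Y) addr0 add0r.
  exact: linearD.
have m1 : cdom ch (1 * 1 : G)%g by rewrite mulg1.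
have m2 : cdom (prod_chart ch ch) (1%g : G, 1%g : G) by [].
have X0 : D (X, 0) = X.
  have := chart_diff_comp chart1_is_chart pc chart1_atlas cc chart1_atlas
    chart1_1 m2 m1 (mdiff_pair mid mc) (mdiff_mul _).
  rewrite (chart_diff_pair chart1_atlas chart1_atlas chart1_atlas) //.
  have -> : (fun x : G * G => (x.1 * x.2)%g) \o (fun x => (id x, 1%g)) = id.
    by apply/funext => x /=; rewrite mulg1.
  rewrite chart_diff_id chart_diff_cst => /(congr1 (@^~ X)) /esym; exact.
have Y0 : D (0, Y) = Y.
  have := chart_diff_comp chart1_is_chart pc chart1_atlas cc chart1_atlas
    chart1_1 m2 m1 (mdiff_pair mc mid) (mdiff_mul _).
  rewrite (chart_diff_pair chart1_atlas chart1_atlas chart1_atlas) //.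
  have -> : (fun x : G * G => (x.1 * x.2)%g) \o (fun x => (1%g, id x)) = id.
    by apply/funext => x /=; rewrite mul1g.
  rewrite chart_diff_id chart_diff_cst => /(congr1 (@^~ Y)) /esym; exact.
by rewrite DD X0 Y0.
Qed.

Lemma chart_diff_mulf V (M : topologicalType) (A : set (chart V M))
    (f g : M -> G) (x : M) (k : chart V M) (v : V) :
  is_chart k -> A k -> cdom k x -> f x = 1%g -> g x = 1%g ->
  mdiff A atlas f x -> mdiff A atlas g x ->
  chart_diff k ch (fun x => (f x * g x)%g) x v =
  chart_diff k ch f x v + chart_diff k ch g x v.
Proof.
move=> kP Ak kx fx gx mf mg.
have cc : prod_atlas atlas atlas (prod_chart ch ch).
  by exists ch => //; exists ch.
have pc : is_chart (prod_chart ch ch) by exact: prod_is_chart.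
have df : cdom ch (f x) by rewrite fx.
have dg : cdom ch (g x) by rewrite gx.
have dfg : cdom ch (f x * g x)%g by rewrite fx gx mulg1.
have dfg2 : cdom (prod_chart ch ch) (f x, g x) by [].
have := chart_diff_comp kP pc Ak cc chart1_atlas
  kx dfg2 dfg (mdiff_pair mf mg) (mdiff_mul _).
rewrite (chart_diff_pair Ak chart1_atlas chart1_atlas) // fx gx.
by move=> /(congr1 (@^~ v)) /= fgE; rewrite -chart_diff_mul1 -fgE.
Qed.

End LieGroupCalculus.

(** * One-parameter subgroups *)

Section OneParameter.
Context {R : realType} {n : nat} (G : lieGroupType R n).
Local Notation atlas := (lie_atlas (s := G)).
Local Notation ch := (chart1 G).
Local Notation line := (Chart setT id id : chart R^o R^o).
Implicit Types (X Y Z : 'rV[R]_n) (f g : G -> G) (c d : R^o -> G).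
Local Hint Extern 0 (charts_cover _) => exact: (lie_cover G) : core.
Local Hint Extern 0 (lie_atlas _) => exact: (chart1_atlas G) : core.
Local Hint Extern 0 (cdom _ _) => exact: (chart1_1 G) : core.
Local Hint Extern 0 (is_chart _) => exact: (chart1_is_chart G) : core.
Local Hint Resolve line_is_chart line_atlas_cover : core.

(** Mean value theorem in each coordinate, on a segment that stays inside the ball. *)
Lemma is_diff0_locally_constant m (f : R^o -> 'rV[R]_m) (e : R) :
  (forall t : R^o, `|t| < e -> is_diff t f 0) ->
  forall t : R^o, `|t| < e -> f t = f 0.
Proof.
move=> fd t te; apply/rowP => j.
have dj (u : R^o) : `|u| < e -> 
    is_derive (u : R) (1 : R) (fun s : R => f s ord0 j) (0 : R).
  move=> ue; have := fd u ue => fdu.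
  have dc := differentiableP (differentiable_coord (f u) ord0 j).
  have [dg gE] := is_diff_comp fdu dc.
  apply: DeriveDef; first exact: diff_derivable.
  by rewrite (deriveE _ dg) gE /= linear0.
have bnd (a b u : R) : `|a| < e -> `|b| < e -> a <= u <= b -> `|u| < e.
  move=> /ltr_normlP [a1 a2] /ltr_normlP [b1 b2] /andP [au ub].
  by apply/ltr_normlP; split;
    [apply: le_lt_trans a1; rewrite lerN2|apply: le_lt_trans b2].
have e0 : `|0 : R| < e by rewrite normr0 (le_lt_trans _ te).
have seg (a b : R) : a <= b -> `|a| < e -> `|b| < e -> f a ord0 j = f b ord0 j.
  move=> ab ae be.
  have [||x _] := @MVT_segment R (fun s => f s ord0 j) (fun=> 0) a b ab.
  - by move=> x /itvP xab; apply/dj/(bnd a b); rewrite ?xab.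
  - apply: derivable_within_continuous => x xab.
    have /dj [] // : `|x : R^o| < e.
    by apply: (bnd a b) => //; rewrite !(itvP xab).
  - by rewrite mul0r => /eqP; rewrite subr_eq0 => /eqP.
by have [t0|t0] := leP t 0; [exact: seg|apply/esym/seg => //; exact: ltW].
Qed.

(** First-order data at 0 only, kept apart from the homomorphism property: the product of two
    one-parameter subgroups has a velocity but need not be a homomorphism. *)
Definition velocity c X : Prop :=
  [/\ mdiff (@line_atlas R) atlas c 0, c 0 = 1%g &
      chart_diff line ch c 0 1 = X].

Lemma velocity_chart_diff c X v :
  velocity c X -> chart_diff line ch c 0 v = v *: X.
Proof.
move=> [_ _ <-]; rewrite -[v in LHS]mulr1 -[v * 1]/(v *: 1).
by rewrite -[LHS]/('d _ _ _) linearZ.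
Qed.

Lemma mdiff_line (f : R^o -> R^o) t : differentiable f t ->
  mdiff (@line_atlas R) (@line_atlas R) f t.
Proof.
move=> df; split=> [|_ _ -> -> _ _]; last exact: df.
exact: differentiable_continuous.
Qed.

Lemma velocity_opp c X : velocity c X -> velocity (fun t => c (- t)) (- X).
Proof.
move=> vc; have [mc c0 _] := vc.
have mN : mdiff (@line_atlas R) (@line_atlas R) (-%R : R^o -> R^o) 0.
  exact: mdiff_line.
have mc' : mdiff (@line_atlas R) atlas c (- 0) by rewrite oppr0.
split; last 1 first.
- have := @chart_diff_comp _ _ _ _ _ _ _ (@line_atlas R) (@line_atlas R) atlas
    (-%R : R^o -> R^o) c 0 line line ch.
  rewrite oppr0 c0 => /(_ _ _ _ _ _ _ _ _ mN mc) -> //=.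
  rewrite (velocity_chart_diff _ vc) /chart_diff.
  by rewrite -[line]/line diff_val scaleN1r.
- exact: (mdiff_comp line_atlas_cover line_atlas_cover mN mc').
- by rewrite oppr0.
Qed.

Lemma velocity_mul c d X Y : velocity c X -> velocity d Y ->
  velocity (fun t => (c t * d t)%g) (X + Y).
Proof.
move=> [mc c0 cX] [md d0 dY]; split.
- exact: mdiff_mulf.
- by rewrite c0 d0 mulg1.
- by rewrite -cX -dY (@chart_diff_mulf _ _ _ _ _ (@line_atlas R)).
Qed.

Lemma velocity_comp c X f : f 1%g = 1%g -> mdiff atlas atlas f 1%g ->
  velocity c X -> velocity (f \o c) (tangent1 f X).
Proof.
move=> f1 mf vc; have [mc c0 cX] := vc.
have mf' : mdiff atlas atlas f (c 0) by rewrite c0.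
split.
- exact: (mdiff_comp line_atlas_cover (lie_cover G) mc mf').
- by rewrite /= c0.
- rewrite (@chart_diff_comp _ _ _ _ _ _ _ (@line_atlas R) atlas atlas
    c f 0 line ch ch) ?c0 ?f1 //=.
  by rewrite cX.
Qed.

Lemma one_parameter_subgroup0 c :
  {morph c : s t / s + t >-> (s * t)%g} -> c 0 = 1%g.
Proof.
by move=> cM; have := cM 0 0; rewrite addr0 -{1}[c 0]mulg1 => /mulgI.
Qed.

Lemma one_parameter_velocity c X : one_parameter_subgroup c X ->
  {morph c : s t / s + t >-> (s * t)%g} /\ velocity c X.
Proof.
move=> [cs cM cX]; split=> //; split.
- exact: smooth_mdiff.
- exact: one_parameter_subgroup0.
have [_ +] : mdiff (@line_atlas R) atlas c 0 by exact: smooth_mdiff.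
move=> /(_ line ch erefl (chart1_atlas G) I).
rewrite one_parameter_subgroup0 // => /(_ (chart1_1 G)) dc.
by have [_ <-] := cX; rewrite deriveE.
Qed.

(* e (t + s) = c t * e s * d (- t) and e' 0 = X - X = 0, so e is locally
   constant near 0. *)
Section Uniqueness.
Variables (c d : R^o -> G) (X : 'rV[R]_n).
Hypotheses (cM : {morph c : s t / s + t >-> (s * t)%g}).
Hypotheses (dM : {morph d : s t / s + t >-> (s * t)%g}).
Hypotheses (vc : velocity c X) (vd : velocity d X).

Let e t := (c t * d (- t))%g.

Let ve : velocity e 0.
Proof.
by rewrite -(subrr X); apply: velocity_mul => //; exact: velocity_opp.
Qed.

Let e_translate t :
  e = (fun x => (c t * x * d (- t))%g) \o (e \o (fun s => s - t)).
Proof.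
apply/funext => s; rewrite /e /= !mulgA -cM addrC subrK -!mulgA -dM.
congr (_ * d _)%g.
by rewrite opprB addrAC subrr sub0r.
Qed.

Let chart_e_diff0 t : cdom ch (e t) -> is_diff t (cmap ch \o e) 0.
Proof.
move=> et; have [me e0 _] := ve.
have ms : mdiff (@line_atlas R) (@line_atlas R) (fun s : R^o => s - t) t.
  by apply: mdiff_line.
have me' : mdiff (@line_atlas R) atlas e (t - t) by rewrite subrr.
have m1 := mdiff_comp line_atlas_cover line_atlas_cover ms me'.
have mt := mdiff_translation (c t) (d (- t)) (1%g : G).
have ee0 : (e \o (fun s => s - t)) t = 1%g by rewrite /= subrr.
have et' : cdom ch (c t * 1 * d (- t))%g by rewrite mulg1.
have mt' : mdiff atlas atlas (fun x => (c t * x * d (- t))%g)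
    ((e \o (fun s => s - t)) t) by rewrite ee0.
have := @is_diff_chart_comp _ _ _ _ _ _ _ (@line_atlas R) atlas atlas
  _ _ t line ch ch line_is_chart (chart1_is_chart G) erefl
  (chart1_atlas G) (chart1_atlas G)
  I _ _ m1 mt'.
rewrite -e_translate ee0 => /(_ (chart1_1 G) et').
have -> // : chart_diff line ch (e \o (fun s => s - t)) t = 0.
  rewrite (@chart_diff_comp _ _ _ _ _ _ _ (@line_atlas R) (@line_atlas R) atlas
    _ e t line line ch) //= ?subrr ?e0 //.
  by apply/funext => v /=; rewrite (velocity_chart_diff _ ve) scaler0.
have -> : chart_diff ch ch (fun x => (c t * x * d (- t))%g) 1%g \o
    (0 : R^o -> 'rV[R]_n) = 0 by apply/funext => v /=; exact: linear0.
by [].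
Qed.

Lemma one_parameter_unique : c =1 d.
Proof.
have [me e0 _] := ve.
(* Near 0 the curve stays in the domain of [ch], so constancy of its coordinates gives constancy of
   [e] itself. *)
have : \forall t \near (0 : R^o), cdom ch (e t).
  have [ce _] := me; apply: ce; rewrite -[X in nbhs X]/(e 0) e0.
  exact: nbhs_cdom.
rewrite -[X in X -> _]/(nbhs _ _) => /nbhs_ballP [r r0 rP].
have eloc t : `|t : R^o| < r -> e t = 1%g.
  move=> tr; have din (s : R^o) : `|s| < r -> cdom ch (e s).
    by move=> sr; apply: rP; rewrite /ball /= sub0r normrN.
  have := @is_diff0_locally_constant _ (cmap ch \o e) r _ t tr.
  move=> /(_ (fun s sr => chart_e_diff0 (din s sr))) /= /(congr1 (cinv ch)).
  by rewrite !cmapK // ?e0 //; apply: din; rewrite ?normr0.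
have cd t : `|t : R^o| < r -> c t = d t.
  move=> tr; have := eloc t tr; rewrite /e => /(congr1 (fun x => x * d t)%g).
  by rewrite -mulgA -dM addNr (one_parameter_subgroup0 dM) mulg1 mul1g.
have cX b : {morph b : s t / (s : R^o) + t >-> (s * t : G)%g} -> forall k t,
    b (t *+ k) = (b t ^+ k)%g.
  move=> bM; elim=> [|k IH] t.
    by rewrite mulr0n (one_parameter_subgroup0 bM).
  by rewrite mulrS bM IH expgS.
(* From the ball to the whole line: t / k.+1 lies in the ball, and both curves at t are the k.+1-th
   powers of their values there. *)
move=> t; have [k kt] : exists k : nat, `|t| / r < k.+1%:R.
  exists (Num.truncn (`|t| / r)); exact: truncnS_gt.
have -> : t = (t / k.+1%:R) *+ k.+1 by rewrite -mulr_natr divfK // pnatr_eq0.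
rewrite !cX // cd // normrM normfV normr_nat ltr_pdivrMr ?ltr0Sn //.
by rewrite mulrC -ltr_pdivrMr.
Qed.

End Uniqueness.

End OneParameter.

(** * The adjoint representation *)

Section AdjointCalculus.
Context {R : realType} {n : nat} (G : lieGroupType R n).
Local Notation atlas := (lie_atlas (s := G)).
Local Notation ch := (chart1 G).
Local Notation line := (Chart setT id id : chart R^o R^o).
Local Notation v0 := (cmap ch 1%g).
Implicit Types (X Y Z : 'rV[R]_n) (f g : G -> G) (c d : R^o -> G) (a b : G).
Local Hint Extern 0 (charts_cover _) => exact: (lie_cover G) : core.
Local Hint Extern 0 (lie_atlas _) => exact: (chart1_atlas G) : core.
Local Hint Extern 0 (cdom _ _) => exact: (chart1_1 G) : core.
Local Hint Extern 0 (is_chart _) => exact: (chart1_is_chart G) : core.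
Local Hint Resolve line_is_chart line_atlas_cover : core.

Lemma differentiable_rV (V : normedModType R) m (f : V -> 'rV[R]_m) (x : V) :
  (forall j, differentiable (fun u => f u ord0 j : R^o) x) ->
  differentiable f x.
Proof.
move=> df.
have -> : f = \sum_(j < m) (fun u => f u ord0 j *: delta_mx ord0 j).
  by apply/funext => u; rewrite fct_sumE [LHS]row_sum_delta.
apply: differentiable_sum => j; exact: differentiableZl.
Qed.

Lemma Ad_linear a : linear (Ad a : 'rV[R]_n -> 'rV[R]_n).
Proof. exact: linearP. Qed.

Let conj a (x : G) : G := (a * x * a^-1)%g.

Let conj1 a : conj a 1%g = 1%g.
Proof. by rewrite /conj mulg1 mulgV. Qed.

Let mdiff_conj a : mdiff atlas atlas (conj a) 1%g.
Proof. exact: mdiff_translation. Qed.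

Lemma AdM a b X : Ad (a * b)%g X = Ad a (Ad b X).
Proof.
have := tangent1_comp (conj1 b) (conj1 a) (mdiff_conj b) (mdiff_conj a).
move=> /(congr1 (@^~ X)); apply: etrans.
by congr (tangent1 _ X); apply/funext => x; rewrite /conj /= invgM !mulgA.
Qed.

Lemma Ad1 X : Ad (1 : G)%g X = X.
Proof.
rewrite /Ad (_ : (fun x => _) = id); last first.
  by apply/funext => x; rewrite invg1 mulg1 mul1g.
by rewrite /tangent1 -[LHS]/(chart_diff ch ch id 1%g X) chart_diff_id.
Qed.

Lemma AdK a X : Ad a (Ad a^-1%g X) = X.
Proof. by rewrite -AdM mulgV Ad1. Qed.

Lemma AdVK a X : Ad a^-1%g (Ad a X) = X.
Proof. by rewrite -AdM mulVg Ad1. Qed.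

Lemma morph1 f : {morph f : x y / (x * y)%g} -> f 1%g = 1%g.
Proof.
by move=> fM; have := fM 1%g 1%g; rewrite mulg1 -{1}[f 1%g]mulg1 => /mulgI.
Qed.

Lemma morphVg f a : {morph f : x y / (x * y)%g} -> f a^-1%g = (f a)^-1%g.
Proof.
move=> fM; apply: (mulgI (f a)); rewrite -fM !mulgV; exact: morph1.
Qed.

(** Both sides differentiate the same map at 1: [f] after conjugation by [a] is conjugation by [f a]
    after [f]. *)
Lemma tangent1_Ad f a X : {morph f : x y / (x * y)%g} ->
  mdiff atlas atlas f 1%g -> tangent1 f (Ad a X) = Ad (f a) (tangent1 f X).
Proof.
move=> fM mf; have f1 := morph1 fM.
have := tangent1_comp (conj1 a) f1 (mdiff_conj a) mf.
move=> /(congr1 (@^~ X)) fE.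
have := tangent1_comp f1 (conj1 (f a)) mf (mdiff_conj (f a)).
move=> /(congr1 (@^~ X)); apply: etrans; apply: etrans (esym fE) _.
by congr (tangent1 _ X); apply/funext => x; rewrite /conj /= !fM (morphVg _ fM).
Qed.

(** * Multiplication in coordinates and differentiability of the adjoint representation *)

Let m : 'rV[R]_n * 'rV[R]_n -> 'rV[R]_n :=
  cmap ch \o (fun x : G * G => (x.1 * x.2)%g) \o cinv (prod_chart ch ch).

Let pc : is_chart (prod_chart ch ch).
Proof. exact: prod_is_chart. Qed.

Let cc : prod_atlas atlas atlas (prod_chart ch ch).
Proof. by exists ch => //; exists ch. Qed.

Let m_smooth a b w : cdom ch a -> cdom ch b -> cdom ch (a * b)%g ->
  differentiable m (cmap ch a, cmap ch b) /\
  differentiable ('D_w m) (cmap ch a, cmap ch b).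
Proof.
move=> ca cb cab; have [_ ms] := @lie_mul_smooth R n G.
have mU : (cmap (prod_chart ch ch) @` (cdom (prod_chart ch ch) `&`
    (fun x : G * G => (x.1 * x.2)%g) @^-1` cdom ch)) (cmap ch a, cmap ch b).
  by exists (a, b).
(* Order 2 is what is required: [Ad] is already a first derivative of the multiplication, and it has
   to be differentiated once more. *)
have [dm Dm] := ms _ _ cc (chart1_atlas G) 2%N.
by split; [exact: dm|have [+ _] := Dm w; apply].
Qed.

Let chart_diff_m a b w : cdom ch a -> cdom ch b -> cdom ch (a * b)%g ->
  chart_diff (prod_chart ch ch) ch (fun x : G * G => (x.1 * x.2)%g) (a, b) w
  = 'D_w m (cmap ch a, cmap ch b).
Proof.
by move=> ca cb cab; rewrite deriveE //; have [] := m_smooth 0 ca cb cab.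
Qed.

Let left_translation_diff a Y : cdom ch a ->
  chart_diff ch ch (fun x => a * x)%g 1%g Y = 'D_(0, Y) m (cmap ch a, v0).
Proof.
move=> ca; have ca1 : cdom ch (a * 1)%g by rewrite mulg1.
have mid : mdiff atlas atlas id (1%g : G) by exact/mdiff_id/lie_atlasP.
have mc : mdiff atlas atlas (fun=> a) (1%g : G) by exact: mdiff_cst.
have ca2 : cdom (prod_chart ch ch) (a, 1%g) by [].
have := chart_diff_comp (chart1_is_chart G) pc (chart1_atlas G) cc
  (chart1_atlas G) (chart1_1 G) ca2 ca1 (mdiff_pair mc mid) (mdiff_mul _).
rewrite (chart_diff_pair (chart1_atlas G) (chart1_atlas G) (chart1_atlas G)) //.
move=> /(congr1 (@^~ Y)) /= E; rewrite -chart_diff_m // [LHS]E.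
by rewrite chart_diff_id chart_diff_cst.
Qed.

(* Only directional derivatives of the multiplication m occur on the right, so
   the differentiability of Ad follows without composing C^2 maps. *)
Let Ad_chart a Y : cdom ch a -> cdom ch a^-1%g ->
  Ad a Y = 'D_('D_(0, Y) m (cmap ch a, v0), 0) m (cmap ch a, cmap ch a^-1%g).
Proof.
move=> ca cVa; have ca1 : cdom ch (a * 1)%g by rewrite mulg1.
have caV : cdom ch (a * 1 * a^-1)%g by rewrite mulg1 mulgV.
have ma : mdiff atlas atlas (fun x => a * x)%g (1%g : G).
  have := mdiff_translation a 1%g (1%g : G).
  by under eq_fun do rewrite mulg1.
have mc : mdiff atlas atlas (fun=> a^-1%g) (1%g : G) by exact: mdiff_cst.
have ca2 : cdom (prod_chart ch ch) (a * 1, a^-1)%g by [].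
have := chart_diff_comp (chart1_is_chart G) pc (chart1_atlas G) cc
  (chart1_atlas G) (chart1_1 G) ca2 caV (mdiff_pair ma mc) (mdiff_mul _).
rewrite (chart_diff_pair (chart1_atlas G) (chart1_atlas G) (chart1_atlas G)) //.
move=> /(congr1 (@^~ Y)) /= E.
rewrite -left_translation_diff // -chart_diff_m ?mulgV // [LHS]E.
by rewrite chart_diff_cst mulg1.
Qed.

Let near_inv : \forall u \near v0,
  [/\ cimg ch u, cdom ch (cinv ch u) & cdom ch (cinv ch u)^-1%g].
Proof.
have h1 : \forall u \near v0, cimg ch u by exact: nbhs_cimg.
have [ci _] : mdiff atlas atlas (fun x => x^-1)%g (1%g : G) by exact: mdiff_inv.
have h2 : \forall u \near v0, cdom ch (cinv ch u)^-1%g.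
  have cv := cvg_comp _ _ (cinv_cvg (chart1_is_chart G) (chart1_1 G)) ci.
  by apply: cv; rewrite invg1; exact: nbhs_cdom.
by near=> u; split; [near: u|apply: cdom_cinv => //; near: u|near: u].
Unshelve. all: by end_near. Qed.

(** In [Ad_chart] the direction of the outer derivative varies with the point. Expanding this
    direction [w u] in the standard basis leaves derivatives [D j] of [m] along fixed vectors, which
    are differentiable since [m] is of class C^2. *)
Lemma Ad_differentiable Y : differentiable (fun u => Ad (cinv ch u) Y) v0.
Proof.
pose i u := cmap ch (cinv ch u)^-1%g.
have i0 : i v0 = v0 by rewrite /i cmapK // invg1.
have di : differentiable i v0.
  have [_ +] : mdiff atlas atlas (fun x => x^-1)%g (1%g : G).
    exact: mdiff_inv.
  by apply; rewrite ?invg1.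
have c11 : cdom ch (1 * 1 : G)%g by rewrite mulg1.
pose w u := 'D_(0, Y) m (u, v0).
pose D j u := 'D_(delta_mx ord0 j, 0) m (u, i u).
have dw : differentiable w v0.
  have := @differentiable_comp _ _ _ _ (fun u => (u, v0)) ('D_(0, Y) m) v0.
  apply; first exact: differentiable_pair.
  by have [] := m_smooth (0, Y) (chart1_1 G) (chart1_1 G) c11.
have dD j : differentiable (D j) v0.
  have := @differentiable_comp _ _ _ _ (fun u => (u, i u))
    ('D_(delta_mx ord0 j, 0) m) v0.
  apply; first exact: differentiable_pair.
  rewrite i0.
  by have [] := m_smooth (delta_mx ord0 j, 0) (chart1_1 G) (chart1_1 G) c11.
have coord k (h : 'rV[R]_n -> 'rV[R]_n) : differentiable h v0 ->
    differentiable (fun u => h u ord0 k : R^o) v0.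
  move=> dh; exact: (differentiable_comp dh (differentiable_coord _ _ _)).
have dS : differentiable (fun u => \sum_(j < n) w u ord0 j *: D j u) v0.
  apply: differentiable_rV => k.
  have -> : (fun u => (\sum_(j < n) w u ord0 j *: D j u) ord0 k : R^o) =
      \sum_(j < n) (fun u => w u ord0 j : R^o) * (fun u => D j u ord0 k : R^o).
    apply/funext => u; rewrite fct_sumE summxE.
    by apply: eq_bigr => j _; rewrite mxE.
  by apply: differentiable_sum => j; apply: differentiableM; exact: coord.
have := differentiableP dS => /near_eq_is_diff E.
suff /E[//] : \forall u \near v0,
  (\sum_(j < n) w u ord0 j *: D j u) = Ad (cinv ch u) Y.
apply: filterS near_inv => u [cu du dVu].
rewrite Ad_chart // cinvK // -/(w u) -/(i u).
have c1 : cdom ch (cinv ch u * (cinv ch u)^-1)%g by rewrite mulgV.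
have [dm _] := m_smooth 0 du dVu c1; rewrite cinvK // -/(i u) in dm.
pose L v := 'd m (u, i u) (v, 0).
have LP : linear L.
  move=> k x y; rewrite /L -linearP; congr ('d m _ _).
  by rewrite -[RHS]/(k *: x + y, k *: 0 + 0) scaler0 addr0.
rewrite deriveE // -/(L _) [in RHS](row_sum_delta (w u)).
pose LL : {linear 'rV[R]_n -> 'rV[R]_n} :=
  HB.pack L (GRing.isLinear.Build _ _ _ _ _ LP).
rewrite -[L]/(LL : _ -> _) linear_sum; apply: eq_bigr => j _.
by rewrite linearZ /= /L /D deriveE.
Qed.

(** Passing from the directional derivative to the total differential makes linearity in [X]
    immediate. *)
Lemma lie_bracketE X Y :
  lie_bracket G X Y = 'd (fun u => Ad (cinv ch u) Y) v0 X.
Proof. by rewrite /lie_bracket deriveE //; exact: Ad_differentiable. Qed.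

Lemma lie_bracket_linearl Y : linear (lie_bracket G ^~ Y).
Proof. by move=> k X Z; rewrite !lie_bracketE linearP. Qed.

Lemma lie_bracket_linearr X : linear (lie_bracket G X).
Proof.
move=> k Y Z.
have dY := differentiableP (Ad_differentiable Y).
have dZ := differentiableP (Ad_differentiable Z).
have [|_ D] := near_eq_is_diff (g := fun u => Ad (cinv ch u) (k *: Y + Z)) _
  (is_diffD (is_diffZ k dY) dZ).
  by near=> u; exact/esym/Ad_linear.
rewrite !lie_bracketE; exact: (congr1 (@^~ X) D).
Unshelve. all: by end_near. Qed.

(** [tangent1_Ad] with the group element varying near 1 is an equality of two germs at [v0]; their
    differentials, given by the chain rule, are the two sides. *)
Lemma tangent1_bracket f X Y : {morph f : x y / (x * y)%g} ->
  mdiff atlas atlas f 1%g ->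
  tangent1 f (lie_bracket G X Y) = lie_bracket G (tangent1 f X) (tangent1 f Y).
Proof.
move=> fM mf; have f1 := morph1 fM; have [fc fd] := mf.
have df : differentiable (cmap ch \o f \o cinv ch) v0.
  by apply: fd => //; rewrite f1.
have dfE : (cmap ch \o f \o cinv ch) v0 = v0 by rewrite /= cmapK // f1.
(* [tangent1 f] is linear and continuous, hence its own differential everywhere. *)
have dL x : is_diff x (tangent1 f) (tangent1 f).
  have Lc : continuous ('d (cmap ch \o f \o cinv ch) v0).
    exact: diff_continuous.
  by apply: DiffDef; [exact: linear_differentiable|exact: diff_lin].
have d1 := is_diff_comp (differentiableP (Ad_differentiable Y)) (dL _).
have dAd := Ad_differentiable (tangent1 f Y).
have d2 : is_diff ((cmap ch \o f \o cinv ch) v0)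
    (fun u => Ad (cinv ch u) (tangent1 f Y))
    ('d (fun u => Ad (cinv ch u) (tangent1 f Y)) v0).
  by rewrite dfE; exact: differentiableP.
have d3 := is_diff_comp (differentiableP df) d2.
have E : \forall u \near v0,
    (tangent1 f \o (fun u => Ad (cinv ch u) Y)) u =
    ((fun u => Ad (cinv ch u) (tangent1 f Y)) \o (cmap ch \o f \o cinv ch)) u.
  have cv := cvg_comp _ _ (cinv_cvg (chart1_is_chart G) (chart1_1 G)) fc.
  have : \forall u \near v0, cdom ch (f (cinv ch u)).
    by apply: cv; rewrite f1; exact: nbhs_cdom.
  apply: filterS => u cu /=; rewrite (cmapK (chart1_is_chart G) cu).
  exact: tangent1_Ad.
have [_ d1E] := near_eq_is_diff E d1; have [_ d3E] := d3.
rewrite !lie_bracketE; exact: (congr1 (@^~ X) (etrans (esym d1E) d3E)).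
Qed.

Lemma Ad_velocity c X Y : velocity c X ->
  is_diff (0 : R^o) (fun t => Ad (c t) Y) (fun r => r *: lie_bracket G X Y).
Proof.
move=> vc; have [mc c0 _] := vc; have [cc0 cd] := mc.
have dc : differentiable (cmap ch \o c) (0 : R^o).
  by apply: (cd line ch) => //; rewrite c0.
have d2 : is_diff ((cmap ch \o c) 0) (fun u => Ad (cinv ch u) Y)
    ('d (fun u => Ad (cinv ch u) Y) v0).
  by rewrite /= c0; exact: differentiableP (Ad_differentiable Y).
have d3 := is_diff_comp (differentiableP dc) d2.
have -> : (fun r : R^o => r *: lie_bracket G X Y) =
    'd (fun u => Ad (cinv ch u) Y) v0 \o 'd (cmap ch \o c) (0 : R^o).
  apply/funext => r /=.
  by rewrite -[X in 'd _ _ X]/(chart_diff line ch c 0 r)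
    (velocity_chart_diff _ vc) linearZ lie_bracketE.
apply: near_eq_is_diff d3.
have : \forall t \near (0 : R^o), cdom ch (c t).
  by apply: cc0; rewrite c0; exact: nbhs_cdom.
by apply: filterS => t ct /=; rewrite cmapK.
Qed.

End AdjointCalculus.

(** * The Killing form *)

Section KillingForm.
Context {R : realType} {n : nat} (G : lieGroupType R n).
Local Notation atlas := (lie_atlas (s := G)).
Implicit Types (X Y Z U V : 'rV[R]_n) (g : G) (c : R^o -> G).

Lemma mul_lin1_mx p q (f : 'rV[R]_p -> 'rV[R]_q) u :
  linear f -> u *m lin1_mx f = f u.
Proof.
move=> fl.
pose F : {linear 'rV[R]_p -> 'rV[R]_q} :=
  HB.pack f (GRing.isLinear.Build _ _ _ _ _ fl).
exact: (mul_rV_lin1 F).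
Qed.

Lemma linear_comp p q r (f : 'rV[R]_q -> 'rV[R]_r) (h : 'rV[R]_p -> 'rV[R]_q) :
  linear f -> linear h -> linear (f \o h).
Proof. by move=> fl hl k x y /=; rewrite hl fl. Qed.

(** Matrices act on row vectors from the right, which reverses the order of composition. *)
Lemma lin1_mx_comp p q r (f : 'rV[R]_q -> 'rV[R]_r) (h : 'rV[R]_p -> 'rV[R]_q) :
  linear f -> linear h -> lin1_mx (f \o h) = lin1_mx h *m lin1_mx f.
Proof.
move=> fl hl; apply/row_matrixP => i; rewrite !rowE mulmxA !mul_lin1_mx //.
exact: linear_comp.
Qed.

Lemma mxtrace_lin1_conj p (f h h' : 'rV[R]_p -> 'rV[R]_p) :
  linear f -> linear h -> linear h' -> cancel h h' ->
  \tr (lin1_mx (h \o f \o h')) = \tr (lin1_mx f).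
Proof.
move=> fl hl hl' hK; rewrite lin1_mx_comp //; last exact: linear_comp.
rewrite lin1_mx_comp // mxtrace_mulC -mulmxA -lin1_mx_comp //.
suff -> : lin1_mx (h' \o h) = 1%:M by rewrite mulmx1.
apply/row_matrixP => i; rewrite !rowE mul_lin1_mx; last exact: linear_comp.
by rewrite /= hK mulmx1.
Qed.

Lemma lin1_mx_linear p q k (h f f' : 'rV[R]_p -> 'rV[R]_q) :
  (forall u, h u = k *: f u + f' u) ->
  lin1_mx h = k *: lin1_mx f + lin1_mx f'.
Proof. by move=> hE; apply/matrixP => i j; rewrite !mxE hE !mxE. Qed.

Lemma lin1_mx0 p q (h : 'rV[R]_p -> 'rV[R]_q) :
  (forall u, h u = 0) -> lin1_mx h = 0.
Proof. by move=> h0; apply/matrixP => i j; rewrite !mxE h0 mxE. Qed.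

Lemma ad_ad_linear X Y :
  linear (fun Z => lie_bracket G X (lie_bracket G Y Z)).
Proof. apply: linear_comp; exact: lie_bracket_linearr. Qed.

Lemma killing_form_linearl Y : linear (fun X => killing_form G X Y : R^o).
Proof.
move=> k X X'.
have E := @lin1_mx_linear n n k
  (fun Z => lie_bracket G (k *: X + X') (lie_bracket G Y Z))
  (fun Z => lie_bracket G X (lie_bracket G Y Z))
  (fun Z => lie_bracket G X' (lie_bracket G Y Z))
  (fun Z => lie_bracket_linearl G (lie_bracket G Y Z) k X X').
have := congr1 mxtrace E; rewrite mxtraceD mxtraceZ; exact.
Qed.

(** [Ad g] preserves brackets, so ad (Ad g X) is the conjugate of ad X by [Ad g], and the trace does
    not see the conjugation. *)
Lemma killing_form_Ad g X Y :
  killing_form G (Ad g X) (Ad g Y) = killing_form G X Y.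
Proof.
have AdB U V : Ad g (lie_bracket G U V) = lie_bracket G (Ad g U) (Ad g V).
  apply: tangent1_bracket; last exact: mdiff_translation.
  by move=> x y; rewrite !mulgA mulgVK.
have := @mxtrace_lin1_conj n (fun Z => lie_bracket G X (lie_bracket G Y Z))
  (Ad g) (Ad g^-1%g) (ad_ad_linear X Y) (Ad_linear g)
  (Ad_linear g^-1%g) (AdVK g).
move=> E; apply: etrans E; congr (\tr (lin1_mx _)).
by apply/funext => Z /=; rewrite !AdB AdK.
Qed.

(** The difference quotients along the null sequence 4 / 2 ^+ m vanish, so the remainder bound at
    these points reads |L| <= e for every positive e. *)
Lemma dyadic_diff0 (f : R^o -> 'rV[R]_n) L :
  is_diff (0 : R^o) f (fun r => r *: L) ->
  (forall m : nat, f (4 / 2 ^+ m) = f 0) -> L = 0.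
Proof.
move=> [df fE] fm; apply/eqP; rewrite -normr_le0; apply/ler_addgt0Pl => e e0.
rewrite addr0.
have := diff_locally df; rewrite fE => /eqaddoP /(_ e e0).
rewrite near_simpl => /nbhs_ballP [r r0 rP].
have [m mr] : exists m : nat, 4 / 2 ^+ m < r :> R.
  have [m mr] : exists m : nat, 4 / r < m%:R :> R.
    by exists (Num.truncn (4 / r)).+1; exact: truncnS_gt.
  exists m; rewrite ltr_pdivrMr ?exprn_gt0 // mulrC -ltr_pdivrMr //.
  apply: lt_le_trans mr _; rewrite -natrX ler_nat; apply: ltnW; exact: ltn_expl.
have h0 : 0 < 4 / 2 ^+ m :> R by rewrite divr_gt0 ?exprn_gt0.
have := rP (4 / 2 ^+ m : R^o); rewrite /ball /= sub0r normrN.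
rewrite gtr0_norm // => /(_ mr).
set h : R := 4 / 2 ^+ m in h0 *.
have -> : (f \o shift (0 : R^o) - (cst (f 0) + (fun s : R^o => s *: L))) h =
  f (h + 0) - (f 0 + h *: L) by [].
rewrite addr0 fm opprD addrA subrr sub0r normrN normrZ gtr0_norm // mulrC.
by rewrite ler_pM2r.
Qed.

(** * The positive definite form of a Cartan involution *)

Section CartanInvolution.
Variable theta : G -> G.
Hypothesis thetaP : cartan_involution theta.

Definition cartan_form U V := - killing_form G U (tangent1 theta V).

Lemma cartan_form_linearl V : linear (fun U => cartan_form U V : R^o).
Proof.
move=> k U U'; rewrite /cartan_form.
rewrite (killing_form_linearl (tangent1 theta V)) opprD.
by rewrite scalerN.
Qed.

Lemma cartan_form_ge0 U : 0 <= cartan_form U U.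
Proof.
have [->|U0] := eqVneq U 0; last by apply/ltW; case: thetaP => _; apply.
have := cartan_form_linearl 0 (-1) 0 0; rewrite scaler0 addr0 scaleN1r.
by rewrite addNr => ->.
Qed.

(** Moving [theta] past [Ad g] yields [Ad (theta g)], here the inverse of [Ad g]; invariance of the
    Killing form carries it to the other argument as [Ad g]. *)
Lemma cartan_form_Ad_sym g U V : theta g = (g^-1)%g ->
  cartan_form (Ad g U) V = cartan_form U (Ad g V).
Proof.
case: thetaP => -[thetaM thetas _] _ tg; rewrite /cartan_form.
rewrite (tangent1_Ad _ _ thetaM); last exact: smooth_mdiff.
by rewrite tg -[X in _ = - killing_form _ X _](AdVK g) killing_form_Ad.
Qed.

(* [Ad g] is diagonalizable with real eigenvalues, being symmetric for a
   definite form; here W = S^2 U - U lies in the (-1)-eigenspace of S^2. *)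
Lemma Ad_expg4 g : theta g = (g^-1)%g ->
  (forall U, Ad (g * g * (g * g))%g U = U) -> forall U, Ad (g * g)%g U = U.
Proof.
move=> tg g4 U; pose W := Ad (g * g)%g U - U.
have lin := Ad_linear (g * g)%g.
have g2W : Ad (g * g)%g W = - W.
  have E := lin (-1) U (Ad (g * g)%g U).
  rewrite !scaleN1r -(AdM (g * g)%g) g4 in E.
  by rewrite /W [_ - U]addrC [LHS]E opprD opprK addrC.
(* The value b(S^2 W, W) equals b(S W, S W), which is nonnegative, but also - b(W, W), which is
   negative unless W = 0. *)
have h1 : cartan_form (Ad (g * g)%g W) W = cartan_form (Ad g W) (Ad g W).
  by rewrite AdM cartan_form_Ad_sym.
have h2 : cartan_form (- W) W = - cartan_form W W.
  (* Linearity is available for combinations k *: U + U', so - W is written as -2 *: W + W. *)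
  have := cartan_form_linearl W (-2) W W; rewrite -{2}[W]scale1r -scalerDl.
  have -> : -2 + 1 = -1 :> R by rewrite -[2]/(1 + 1) opprD addrNK.
  move=> E; rewrite -[- W]scaleN1r [LHS]E.
  rewrite -{2}[cartan_form W W]scale1r -scalerDl -[2]/(1 + 1) opprD.
  by rewrite addrNK scaleN1r.
have W0 : W = 0.
  apply/eqP/negPn/negP => Wn0.
  have W_gt0 : 0 < cartan_form W W by case: thetaP => _; apply.
  have := cartan_form_ge0 (Ad g W).
  by rewrite -h1 g2W h2 oppr_ge0 leNgt W_gt0.
by apply/eqP; rewrite -subr_eq0 -/W W0.
Qed.

Lemma periodic_velocity0 c X : {morph c : s t / s + t >-> (s * t)%g} ->
  velocity c X -> tangent1 theta X = - X -> c 4 = 1%g -> X = 0.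
Proof.
move=> cM vc tX c4; have [[thetaM thetas _] pos] := thetaP.
have mt (x : G) : mdiff atlas atlas theta x by exact: smooth_mdiff.
(* The curves theta (c t) and c (- t) are homomorphisms with the same velocity - X, hence equal. *)
have tc t : theta (c t) = ((c t)^-1)%g.
  have t1 := morph1 thetaM.
  have tcM : {morph (theta \o c) : s t / s + t >-> (s * t)%g}.
    by move=> s u /=; rewrite cM thetaM.
  have cNM : {morph (fun t => c (- t)) : s t / s + t >-> (s * t)%g}.
    by move=> s u /=; rewrite opprD cM.
  have v1 := velocity_comp t1 (mt _) vc; rewrite tX in v1.
  have := one_parameter_unique tcM cNM v1 (velocity_opp vc) t; rewrite /= => ->.
  apply: (mulgI (c t)); rewrite -cM subrr mulgV.
  exact: one_parameter_subgroup0.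
have Adc m U : Ad (c (4 / 2 ^+ m)) U = U.
  elim: m U => [|m IH] U; first by rewrite expr0 divr1 c4 Ad1.
  have E (k : nat) :
      c (4 / 2 ^+ k) = (c (4 / 2 ^+ k.+1)%R * c (4 / 2 ^+ k.+1)%R)%g.
    by rewrite -cM exprSr invfM mulrA -splitr.
  (* The element fed to [Ad_expg4] lies two halvings below the induction hypothesis: its fourth
     power is c (4 / 2 ^+ m), its square the element at the new level. *)
  rewrite (E m.+1); apply: Ad_expg4 => [|V]; first exact: tc.
  rewrite -(E m.+1) -(E m); exact: IH.
have ad0 Y : lie_bracket G X Y = 0.
  apply: (dyadic_diff0 (Ad_velocity Y vc)) => m.
  by rewrite Adc (one_parameter_subgroup0 cM) Ad1.
(* With ad X = 0 the trace defining the Killing form vanishes, against definiteness at a nonzero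
   X. *)
apply/eqP/negPn/negP => /pos; suff -> : killing_form G X (tangent1 theta X) = 0.
  by rewrite oppr0 ltxx.
by rewrite /killing_form lin1_mx0 ?mxtrace0 // => Z; exact: ad0.
Qed.

End CartanInvolution.

(** * The exponential map on (-1)-eigenspaces *)

Lemma lie_exp0 : lie_exp G 0 = 1%g.
Proof.
rewrite /lie_exp; case: xgetP => // _ -> [c /one_parameter_velocity [cM vc] <-].
have v1 : velocity (fun=> 1%g : G) 0.
  split=> //; first exact: mdiff_cst.
  by rewrite chart_diff_cst.
by apply: (one_parameter_unique cM _ vc v1) => s t; rewrite mulg1.
Qed.

Lemma lie_expN f X : {morph f : x y / (x * y)%g} ->
  smooth_map atlas atlas f -> tangent1 f X = - X ->
  f (lie_exp G X) = (lie_exp G X)^-1%g.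
Proof.
move=> fM fs fX; have f1 := morph1 fM; rewrite /lie_exp.
(* In the default branch the exponential is 1, which satisfies the equation; otherwise it is the
   value at 1 of an actual curve. *)
case: xgetP => [_ ->|_]; last by rewrite f1 invg1.
move=> [c /one_parameter_velocity [cM vc] <-].
have fcM : {morph (f \o c) : s t / s + t >-> (s * t)%g}.
  by move=> s u /=; rewrite cM fM.
have cNM : {morph (fun t => c (- t)) : s t / s + t >-> (s * t)%g}.
  by move=> s u /=; rewrite opprD cM.
have v1 := velocity_comp f1 (smooth_mdiff _ fs) vc; rewrite fX in v1.
have := one_parameter_unique fcM cNM v1 (velocity_opp vc) 1; rewrite /= => ->.
apply: (mulgI (c 1)); rewrite -cM subrr mulgV.
exact: one_parameter_subgroup0.
Qed.

Lemma lie_exp_torsion (theta : G -> G) X : cartan_involution theta ->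
  tangent1 theta X = - X ->
  (lie_exp G X * lie_exp G X * (lie_exp G X * lie_exp G X))%g = 1%g ->
  lie_exp G X = 1%g.
Proof.
(* For nonzero X a curve with velocity X would satisfy c 4 = (c 1)^4 = 1, which is impossible; only
   the default value 1 of [xget] remains. *)
move=> thetaP tX; have [X0|Xn0] := eqVneq X 0; first by rewrite X0 lie_exp0.
rewrite /lie_exp; case: xgetP => [a -> /= [c]|//].
move=> /one_parameter_velocity [cM vc] c1 a4.
suff /eqP : X = 0 by rewrite (negPf Xn0).
apply: (periodic_velocity0 thetaP cM vc tX).
have -> : 4 = 1 + 1 + (1 + 1) :> R by rewrite -[1]/(1%:R) -!natrD.
by rewrite !cM c1.
Qed.

End KillingForm.

(** * Weyl groups *)

Section DiagonalWeyl.
Local Open Scope group_scope.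
Context {T : groupType} (K H A : set T).
Hypotheses (K_subgroup : subgroup K) (H_subgroup : subgroup H).
Local Notation KH := (K `&` H).
Local Notation N1 := (normalizer conjugation KH A).
Local Notation Z1 := (centralizer conjugation KH A).
Local Notation N2 := (normalizer two_sided (K `*` H) A).
Local Notation Z2 := (centralizer two_sided (K `*` H) A).
Local Notation W1 := (weyl conjugation KH A).
Local Notation W2 := (weyl two_sided (K `*` H) A).
(** The sole input from Lie theory; the section itself concerns an abstract group. *)
Hypothesis N2_diag : forall k h, N2 (k, h) -> k = h.

Lemma subgroup_setI : subgroup KH.
Proof.
case: K_subgroup => K1 KM KV; case: H_subgroup => H1 HM HV; split=> //.
- by move=> x y [Kx Hx] [Ky Hy]; split; [exact: KM|exact: HM].
- by move=> x [Kx Hx]; split; [exact: KV|exact: HV].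
Qed.

Lemma subgroup_setX : subgroup (K `*` H).
Proof.
case: K_subgroup => K1 KM KV; case: H_subgroup => H1 HM HV; split=> //.
- by move=> x y [Kx Hx] [Ky Hy]; split; [exact: KM|exact: HM].
- by move=> x [Kx Hx]; split; [exact: KV|exact: HV].
Qed.

Let sKH := subgroup_setI.
Let sKxH := subgroup_setX.

(** [two_sided (l, l)] and [conjugation l] are convertible, so the conditions on [A] transfer
    without rewriting. *)
Let N12 l : N1 l -> N2 (l, l).
Proof. by move=> [[Kl Hl] Al]. Qed.

Let Z1_subgroup : subgroup Z1.
Proof. exact: (centralizer_subgroup conjugation1 conjugationM). Qed.

Let Z2_subgroup : subgroup Z2.
Proof. exact: (centralizer_subgroup two_sided1 two_sidedM). Qed.

Let Z12 z : Z2 (z, z) <-> Z1 z.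
Proof. by split=> -[[Kz Hz] Az]. Qed.

Lemma diag_class_left_coset l :
  diag_class Z2 (left_coset l Z1) = left_coset (l, l) Z2.
Proof.
have [Z11 _ _] := Z1_subgroup; have [_ Z2M _] := Z2_subgroup.
apply/seteqP; split=> [_ [_ [_ [z Zz <-] <-] [w Zw <-]]|_ [w Zw <-]].
  exists ((z, z) * w); first by apply: Z2M => //; exact/Z12.
  by rewrite mulgA.
exists (l, l); last by exists w.
by exists l => //; exists 1; rewrite ?mulg1.
Qed.

Lemma diag_class_morph :
  {in W1 &, {morph diag_class Z2 : C D / mulset C D}}.
Proof.
move=> _ _ /set_mem [l Nl <-] /set_mem [l' Nl' <-].
rewrite !diag_class_left_coset (mulset_left_coset conjugation1 conjugationM) //.
by rewrite diag_class_left_coset (mulset_left_coset two_sided1 two_sidedM).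
Qed.

Lemma weyl_diagE : W2 = diag_class Z2 @` W1.
Proof.
apply/seteqP; split=> [_ [[k h] Nkh <-]|_ [_ [l Nl <-] <-]].
  have kh := N2_diag Nkh; rewrite -{}kh in Nkh *.
  exists (left_coset k Z1); last exact: diag_class_left_coset.
  by exists k => //; case: Nkh => -[].
by exists (l, l); [exact: N12|rewrite diag_class_left_coset].
Qed.

(** Preimage under the diagonal embedding; on the cosets in [W2] it is the inverse of
    [diag_class Z2]. *)
Let undiag (D : set (T * T)) : set T := [set l | D (l, l)].

Let undiagE l : undiag (left_coset (l, l) Z2) = left_coset l Z1.
Proof.
(* If (l, l) * (z, w) is diagonal, cancelling l gives z = w, and Z2 meets the diagonal exactly in
   Z1. *)
apply/seteqP; split=> [x [[z w] Zzw [<- zw]]|_ [z /Z12 Zz <-]].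
  by move: zw Zzw => /mulgI -> /Z12 Zz; exists z.
by exists (z, z).
Qed.

Lemma weyl_isomorphic : group_isomorphic W2 W1.
Proof.
have W2P D : W2 D -> exists2 l, N1 l & D = left_coset (l, l) Z2.
  rewrite weyl_diagE => -[_ [l Nl <-] <-]; exists l => //.
  exact: diag_class_left_coset.
exists undiag; split; first split.
- by move=> _ /W2P [l Nl ->]; rewrite undiagE; exists l.
- move=> _ _ /set_mem /W2P [l Nl ->] /set_mem /W2P [l' Nl' ->].
  (* Injectivity: each coset in [W2] is recovered by [diag_class] from its image. *)
  by rewrite !undiagE -!diag_class_left_coset => ->.
- move=> _ [l Nl <-]; exists (left_coset (l, l) Z2); last exact: undiagE.
  by exists (l, l) => //; exact: N12.
move=> _ _ /set_mem /W2P [l Nl ->] /set_mem /W2P [l' Nl' ->].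
rewrite (mulset_left_coset two_sided1 two_sidedM) // !undiagE.
by rewrite (mulset_left_coset conjugation1 conjugationM).
Qed.

End DiagonalWeyl.

Lemma fixed_points_subgroup (R : realType) (n : nat) (G : lieGroupType R n)
    (nu : G -> G) :
  {morph nu : x y / (x * y)%g} -> subgroup (fixed_points nu).
Proof.
move=> nuM; split; rewrite /fixed_points /=; first exact: morph1.
- by move=> x y nx ny; rewrite nuM nx ny.
- by move=> x nx; rewrite (morphVg _ nuM) nx.
Qed.

(** Applying sigma to k = a h gives sigma k = a^-1 h, so a^2 (sigma k) = k. Since theta fixes k, and
    also sigma k because the involutions commute, applying theta turns this into a^-2 (sigma k) = k;
    comparing the two yields a^4 = 1. *)
Lemma theta_sigma_expg4 (T : groupType) (sigma theta : T -> T) (a k h : T) :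
  {morph sigma : x y / (x * y)%g} -> {morph theta : x y / (x * y)%g} ->
  (forall g, sigma (theta g) = theta (sigma g)) ->
  theta k = k -> sigma h = h -> sigma a = (a^-1)%g -> theta a = (a^-1)%g ->
  k = (a * h)%g -> (a * a * (a * a) = 1)%g.
Proof.
move=> sM tM st tk sh sa ta kE.
have sk : (a * a * sigma k)%g = k by rewrite kE sM sa sh !mulgA mulgK.
have tsk : theta (sigma k) = sigma k by rewrite -st tk.
have tkE : (a^-1 * a^-1 * sigma k)%g = k.
  by rewrite -[RHS]tk -[in RHS]sk !tM ta tsk.
apply: (mulIg (sigma k)); rewrite mul1g -mulgA sk -{1}tkE !mulgA.
by rewrite mulgK mulgV mul1g.
Qed.

Theorem theorem4p4 (R : realType) (n : nat) (G : lieGroupType R n)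
    (G_connected : connected [set: G])
    (G_noncompact : ~ compact [set: G])
    (G_semisimple : semisimple G)
    (sigma : G -> G) (sigmaP : involutive_automorphism sigma)
    (H : set G) (H_subgroup : subgroup H) (H_closed : closed H)
    (H_lower : connected_component (fixed_points sigma) 1%g `<=` H)
    (H_upper : H `<=` fixed_points sigma)
    (theta : G -> G) (thetaP : cartan_involution theta)
    (sigma_theta : forall g, sigma (theta g) = theta (sigma g))
    (K_connected : connected (fixed_points theta))
    (K_maximal_compact : maximal_compact_subgroup (fixed_points theta))
    (a0 : {vspace 'rV[R]_n})
    (a0P : maximal_abelian_in G
             (minus_eigenspace theta `&` minus_eigenspace sigma) a0) :
  let K := fixed_points theta in
  let KH := K `&` H in
  let A := [set lie_exp G X | X in [set` a0]] in
  let N1 := normalizer conjugation KH A in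
  let Z1 := centralizer conjugation KH A in
  let Z2 := centralizer two_sided (K `*` H) A in
  let W1 := weyl conjugation KH A in
  let W2 := weyl two_sided (K `*` H) A in
  let Delta := diag_class Z2 in
  [/\ (forall l, N1 l -> Delta (left_coset l Z1) = left_coset (l, l) Z2),
      {in W1 &, {morph Delta : C D / mulset C D}},
      W2 = Delta @` W1 &
      group_isomorphic W2 W1].
Proof.
have [sM sS _] := sigmaP; have [[tM tS _] _] := thetaP.
have [[aS _] _] := a0P.
have A1 : [set lie_exp G X | X in [set` a0]] 1%g.
  by exists 0; [exact: mem0v|exact: lie_exp0].
have K_subgroup := fixed_points_subgroup tM.
have diag k h : normalizer two_sided (fixed_points theta `*` H)
    [set lie_exp G X | X in [set` a0]] (k, h) -> k = h.
  move=> [[/= tk /H_upper sh] NA].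
  have [X Xa Xkh] : [set lie_exp G X | X in [set` a0]] (k * h^-1)%g.
    by rewrite -NA; exists 1%g => //; rewrite /two_sided /= mulg1.
  have [tX sX] := aS X Xa.
  have kE : k = (lie_exp G X * h)%g by rewrite Xkh mulgVK.
  have := theta_sigma_expg4 sM tM sigma_theta tk sh (lie_expN sM sS sX)
    (lie_expN tM tS tX) kE.
  by move=> /(lie_exp_torsion thetaP tX) a1; rewrite kE a1 mul1g.
split.
- by move=> l _; exact: diag_class_left_coset.
- exact: diag_class_morph.
- exact: weyl_diagE.
- exact: weyl_isomorphic.
Qed.
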